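(* Let $f:X\to X$ be an acyclic countable-to-one Borel function on a standard probability space $(X,\mu)$, such that $E_f$ is measure-class-preserving, with associated Radon--Nikodym cocycle $\rho$. Then, after discarding a null set, the directed Radon--Nikodym vertex core of $f$ coincides with the Radon--Nikodym vertex core of $T_f$.
   Context: $f$ is acyclic if $f^n(x)\ne x$ for all $n\ge1$, $x\in X$. $T_f$ is the (acyclic) graph $\{(x,y):f(x)=y\text{ or }f(y)=x\}$, and $E_f$ is its connectedness equivalence relation. The back $f$-orbit of $x$ is $f^{-\mathbb N}(x)=\bigcup_{n\ge0}f^{-n}(x)$. A countable Borel equivalence relation $E$ on $X$ is measure-class-preserving (mcp) on $(X,\mu)$ if the $E$-saturation of every null set is null. Its Radon--Nikodym cocycle is the (unique up to null sets) Borel $\rho:E\to(0,\infty)$ with $\rho(z,y)\rho(y,x)=\rho(z,x)$ and, writing $\rho^x(y):=\rho(y,x)$, $\int_X\sum_{y\in[x]_E}h(x,y)\,d\mu(x)=\int_X\sum_{y\in[x]_E}h(y,x)\rho^x(y)\,d\mu(x)$ for all Borel $h:E\to[0,\infty]$. A set $D\subseteq[x]_E$ is $\rho$-infinite if $\sum_{y\in D}\rho^x(y)=\infty$ (independent of $x$ in the class). A half-space of an acyclic graph $T$ is a $T$-connected set $U$ of vertices with exactly one edge joining $U$ to its complement. The Radon--Nikodym vertex core of $T$ is the set of all $x\in X$ such that every half-space of $T$ containing $x$ is $\rho$-infinite. The directed Radon--Nikodym vertex core of $f$ is the set of all $x\in X$ whose back $f$-orbit is $\rho$-infinite. ''After discarding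 a null set'' means: on the complement of some $E_f$-invariant Borel null set. *)

(* Defs.v *)
From Stdlib Require Export Relation_Operators.
From HB Require Export structures.
From mathcomp Require Export all_boot all_order all_algebra.
From mathcomp Require Export all_classical all_reals all_analysis.
From mathcomp Require Export measurable_realfun.

Set Implicit Arguments.
Unset Strict Implicit.
Unset Printing Implicit Defensive.

Export Order.TTheory GRing.Theory Num.Theory.
Export numFieldNormedType.Exports.

Local Open Scope classical_set_scope.
Local Open Scope ring_scope.
Local Open Scope ereal_scope.

(* [X] is, up to the bijection [phi], a Polish space with its Borel
   sigma-algebra.  A pseudometric space is metric iff it is Hausdorff. *)
Definition standard_borel (R : realType) d (X : measurableType d) : Prop :=
  exists (P : completePseudoMetricType R) (phi : X -> P),
    [/\ hausdorff_space P,
        (exists2 D : set P, countable D & dense D),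
        bijective phi &
        (measurable : set (set X)) =
          preimage_set_system setT phi <<s (@open P) >>].

Section Graphs.
Context {X : Type}.
Implicit Types (T : X -> X -> Prop) (U : set X).

(* For a symmetric [T], [clos_refl_trans] is reachability by a finite path. *)
Definition connectedness T : X -> X -> Prop := clos_refl_trans X T.

Definition graph_connected T U : Prop :=
  forall x y, U x -> U y ->
    clos_refl_trans X (fun a b => [/\ T a b, U a & U b]) x y.

(* An undirected edge between [U] and its complement is counted once, oriented
   from its end in [U] to its end outside [U]. *)
Definition half_space T U : Prop :=
  graph_connected T U /\
  exists! e : X * X, [/\ T e.1 e.2, U e.1 & ~ U e.2].

Definition acyclic_fun (f : X -> X) : Prop :=
  forall (n : nat) (x : X), (1 <= n)%N -> iter n f x <> x.

Definition countable_to_one (f : X -> X) : Prop :=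
  forall y, countable (f @^-1` [set y]).

Definition fun_graph (f : X -> X) : X -> X -> Prop :=
  fun x y => f x = y \/ f y = x.

Definition fun_equiv (f : X -> X) : X -> X -> Prop :=
  connectedness (fun_graph f).

Definition back_orbit (f : X -> X) (x : X) : set X :=
  \bigcup_n (iter n f @^-1` [set x]).

Definition eclass (E : X -> X -> Prop) (x : X) : set X := [set y | E x y].

Definition saturation (E : X -> X -> Prop) (A : set X) : set X :=
  \bigcup_(x in A) eclass E x.

Definition invariant_set (E : X -> X -> Prop) (A : set X) : Prop :=
  forall x y, E x y -> A x -> A y.

End Graphs.

Section RadonNikodym.
Context {R : realType} {d : measure_display} {X : measurableType d}.
Variable mu : probability X R.
Implicit Types (E : X -> X -> Prop) (rho : X * X -> R).

Definition mcp E : Prop :=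
  forall A, mu.-negligible A -> mu.-negligible (saturation E A).

(* A cocycle on [E] is a total function on [X * X] of which only the values on
   [E] are constrained; rho^x(y) is [rho (y, x)]. *)
Definition is_RN_cocycle E rho : Prop :=
  [/\ (forall x y, E x y -> (0 < rho (x, y))%R),
      measurable_fun [set p | E p.1 p.2] rho,
      (forall x y z, E x y -> E y z ->
         (rho (z, y) * rho (y, x))%R = rho (z, x)) &
      forall h : X * X -> \bar R,
        measurable_fun [set p | E p.1 p.2] h ->
        (forall x y, E x y -> 0 <= h (x, y)) ->
        \int[mu]_x (\esum_(y in eclass E x) h (x, y)) =
        \int[mu]_x (\esum_(y in eclass E x) (h (y, x) * (rho (y, x))%:E))].

(* The sum does not depend on the base point up to a positive finite factor,
   by the cocycle identity. *)
Definition rho_infinite E rho (D : set X) : Prop :=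
  exists2 x, D `<=` eclass E x & \esum_(y in D) (rho (y, x))%:E = +oo.

Definition RN_vertex_core (T : X -> X -> Prop) rho : set X :=
  [set x | forall U, half_space T U -> U x ->
             rho_infinite (connectedness T) rho U].

Definition directed_RN_vertex_core (f : X -> X) rho : set X :=
  [set x | rho_infinite (fun_equiv f) rho (back_orbit f x)].

End RadonNikodym.

(* Main.v *)
Require Import Defs.
From mathcomp Require Import all_boot all_order all_algebra.
From mathcomp Require Import all_classical all_reals all_analysis.
From mathcomp Require Import lra.

(** Write r(x) for the rho^x-mass of the back orbit of x and K(x) for the
    rho^x-mass of its forward orbit.  The half-spaces of the forest T_f are the
    two sides of its edges, one of them being a back orbit and the other being
    closed under f.  So a half-space containing x contains either the back orbit
    or the forward orbit of x ([half_space_orbit]), and back orbits are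
    themselves half-spaces ([back_orbit_half_space]).  The two cores can
    therefore only differ at points where r(x) is infinite while K(x) is finite,
    and the theorem reduces to the fact that such points form a null set
    ([back_sum_fin_of_forward_sum_fin]).

    This is proved by mass transport along the orbits of f.  If y sends a mass
    w(f^n y, y) to f^n y, then the mass received at z is, in the mean, the mass
    sent, weighted by rho: when the weighted mass sent from each point is
    bounded, the mass received is finite almost everywhere ([back_sum_lty]).
    Apply this twice.  First, let A be the set where K <= C and let each y in A
    send mass 1 to every point of its forward orbit; the weighted total is
    K(y) <= C, so almost every z has only finitely many points of A in its back
    orbit.  That number strictly increases along the visits of a forward orbit
    to A, so the set B of the points of A where it has a given value is visited
    at most once by each forward orbit.  Secondly, let y send mass rho(y, z) to
    the point z where its forward orbit visits B, if there is one; the weighted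
    total is at most 1, so r is finite almost everywhere on B.  Countably many
    such sets B cover, up to a null set, the points where K is finite.

    The sets and functions built from back orbits, such as B, are projections of
    Borel sets, hence not obviously measurable.  Instead of using that
    countable-to-one Borel images are Borel, measurability up to a null set is
    deduced from the cocycle itself.  The integral of a nonnegative function
    that may fail to be measurable is its lower integral, and the mass transport
    identity is assumed for it too.  Let L be a largest measurable subset of the
    image S of a Borel set under f^n.  What is transported to S minus L has
    lower integral 0, hence is sent from a null set, and as the equivalence
    relation preserves null sets, S minus L is null
    ([almost_measurable_image]).  Sums over back orbits are then suprema of
    countably many finite combinations of indicators of such images, obtained
    by grouping the points of a back orbit in finer and finer finite partitions
    ([ae_measurable_back_sum]). *)

Set Implicit Arguments.
Unset Strict Implicit.
Unset Printing Implicit Defensive.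

Local Open Scope classical_set_scope.
Local Open Scope ring_scope.
Local Open Scope ereal_scope.

(** * Standard Borel spaces are countably separated *)

Definition separating {X : Type} (U : nat -> set X) : Prop :=
  forall x y, x <> y -> exists2 i, U i x & ~ U i y.

(** Interiors of balls of radius 1/(k+1) about the points of a dense countable
    set separate points.  The balls about the points of the dense set with a
    given code are united, which spares enumerating that set. *)
Lemma standard_borel_separating (R : realType) d (X : measurableType d) :
  standard_borel R X ->
  exists2 U : nat -> set X, (forall i, measurable (U i)) & separating U.
Proof.
move=> [P [phi [hausP [D cD dD] bij_phi mX]]].
have [g /= g_inj] := countable_injP _ cD.
pose V (mk : nat * nat) : set P :=
  \bigcup_(p in D `&` [set p | g p = mk.1]) (ball p mk.2.+1%:R^-1%R)°.
exists (fun i => phi @^-1` V (odflt (0, 0)%N (unpickle i))) => [i|x y xy].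
  rewrite mX; exists (V (odflt (0, 0)%N (unpickle i))); last by rewrite setTI.
  apply: sub_sigma_algebra; apply: bigcup_open => p _; exact: open_interior.
have phixy : phi x != phi y.
  by apply/eqP => /(bij_inj bij_phi).
move: hausP; rewrite open_hausdorff => /(_ _ _ phixy)[[A B] /=].
rewrite !inE => -[Ax By] [oA oB /eqP AB0].
have /nbhs_ballP[e /= e0 eA] : nbhs (phi x) A by exact: open_nbhs_nbhs.
have [k ke] : exists k : nat, (k.+1%:R^-1 < e / 2 :> R)%R.
  have e20 : (0 < e / 2)%R by rewrite divr_gt0.
  exists (Num.truncn ((e / 2)^-1)); rewrite invf_plt ?posrE//.
  exact: truncnS_gt.
set del := (k.+1%:R^-1 : R)%R in ke *.
have del0 : (0 < del)%R by rewrite invr_gt0.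
have del20 : (0 < del / 2)%R by rewrite divr_gt0.
(* A center closer to phi x than half the radius has phi x in the interior. *)
have [p [xp Dp]] : (ball (phi x) (del / 2))° `&` D !=set0.
  apply: dD; last exact: open_interior.
  by exists (phi x); apply: nbhsx_ballx.
have {}xp := interior_subset xp.
exists (pickle (g p, k)); rewrite pickleK /V /=.
  exists p => //; apply: filterS (nbhsx_ballx (phi x) _ del20) => z xz.
  exact: ball_splitr xp xz.
move=> [q [Dq gqp]] /interior_subset qy.
have qp : q = p by apply: g_inj; rewrite ?inE.
rewrite {}qp in qy.
suff Ay : A (phi y) by have : (A `&` B) (phi y) by []; move/eqP: AB0 => ->.
apply: eA; apply: le_ball (ball_triangle xp qy).
rewrite -/del; lra.
Qed.

(** The complement of the diagonal is the union of the rectangles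
    U_i x (X \ U_i). *)
Lemma measurable_diagonal d (X : measurableType d) (U : nat -> set X) :
  (forall i, measurable (U i)) -> separating U ->
  measurable [set p : X * X | p.1 = p.2].
Proof.
move=> mU sepU.
suff -> : [set p : X * X | p.1 = p.2] = ~` (\bigcup_i (U i `*` ~` U i)).
  apply: measurableC; apply: bigcup_measurable => i _.
  by apply: measurableX => //; exact: measurableC.
apply/seteqP; split => [[x y] /= -> [i _ []//]|[x y] /= nxy].
apply: contrapT => /sepU[i Ux Uy]; apply: nxy; exists i => //.
Qed.

(** * The forest of an acyclic function and its half-spaces *)

Section ForwardOrbits.
Context {X : Type} (f : X -> X).

Definition forward_orbit (y : X) : set X := range (fun n => iter n f y).

Lemma back_orbitP x y : back_orbit f x y <-> exists n, iter n f y = x.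
Proof. by split=> [[n _ /= <-]|[n <-]]; exists n. Qed.

Lemma back_orbit_refl x : back_orbit f x x.
Proof. by exists 0%N. Qed.

Lemma forward_orbitE y x : forward_orbit y x <-> back_orbit f x y.
Proof. by split=> [[n _ <-]|[n _ <-]]; exists n. Qed.

Lemma back_orbit_trans x y z :
  back_orbit f x y -> back_orbit f y z -> back_orbit f x z.
Proof.
move=> /back_orbitP[m <-] /back_orbitP[n <-]; apply/back_orbitP.
by exists (m + n)%N; rewrite iterD.
Qed.

Lemma fun_equiv_step x : fun_equiv f x (f x).
Proof. by apply: rt_step; left. Qed.

Lemma fun_equiv_sym x y : fun_equiv f x y -> fun_equiv f y x.
Proof.
elim=> [a b ab|a|a b c _ ab _ bc]; [|exact: rt_refl|exact: rt_trans bc ab].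
by apply: rt_step; case: ab; [right|left].
Qed.

Lemma fun_equiv_trans x y z : fun_equiv f x y -> fun_equiv f y z ->
  fun_equiv f x z.
Proof. exact: rt_trans. Qed.

Lemma fun_equiv_iter n x : fun_equiv f x (iter n f x).
Proof.
elim: n => [|n IHn]; first exact: rt_refl.
by apply: fun_equiv_trans IHn _; exact: fun_equiv_step.
Qed.

Lemma fun_equivP x y :
  fun_equiv f x y <-> exists m n, iter m f x = iter n f y.
Proof.
split=> [|[m [n fmn]]]; last first.
  apply: fun_equiv_trans (fun_equiv_iter m x) _; rewrite fmn.
  exact/fun_equiv_sym/fun_equiv_iter.
elim=> {x y} [a b [<-|<-]|a|a b c _ [m [n ab]] _ [p [q bc]]].
- by exists 1%N, 0%N.
- by exists 0%N, 1%N.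
- by exists 0%N, 0%N.
- exists (p + m)%N, (n + q)%N.
  by rewrite iterD ab -iterD addnC iterD bc -iterD.
Qed.

Lemma back_orbit_equiv x y : back_orbit f x y -> fun_equiv f y x.
Proof. by move=> /back_orbitP[n <-]; exact: fun_equiv_iter. Qed.

Lemma back_orbit_sub x : back_orbit f x `<=` eclass (fun_equiv f) x.
Proof. by move=> y /back_orbit_equiv/fun_equiv_sym. Qed.

Lemma forward_orbit_sub x : forward_orbit x `<=` eclass (fun_equiv f) x.
Proof. by move=> _ [n _ <-]; exact: fun_equiv_iter. Qed.

Hypothesis f_acyclic : acyclic_fun f.

Lemma iter_inj y : injective (fun n => iter n f y).
Proof.
move=> m n; wlog mn : m n / (m <= n)%N => [hw|] e.
  by case/orP: (leq_total m n) => le; [|symmetry]; apply: hw.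
move: mn; rewrite leq_eqVlt => /orP[/eqP//|mn].
have := @f_acyclic (n - m)%N (iter m f y); rewrite -iterD subnK ?(ltnW mn)//.
by rewrite -e subn_gt0 => /(_ mn).
Qed.

Lemma back_orbit_image x : ~ back_orbit f x (f x).
Proof.
move=> /back_orbitP[n]; rewrite -iterSr; exact: f_acyclic.
Qed.

(** The boundary edge is (x, f x): every other point of the back orbit is mapped
    into it, and preimages never leave it. *)
Lemma back_orbit_half_space x : half_space (fun_graph f) (back_orbit f x).
Proof.
have to_root y : back_orbit f x y ->
    clos_refl_trans X (fun a b => [/\ fun_graph f a b, back_orbit f x a
      & back_orbit f x b]) y x /\
    clos_refl_trans X (fun a b => [/\ fun_graph f a b, back_orbit f x a
      & back_orbit f x b]) x y.
  move=> /back_orbitP[n]; elim: n y => [|n IHn] y.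
    by move=> /= ->; split; exact: rt_refl.
  rewrite iterSr => fn; have [yx xy] := IHn _ fn.
  have fyB : back_orbit f x (f y) by apply/back_orbitP; exists n.
  have yB : back_orbit f x y.
    by apply/back_orbitP; exists n.+1; rewrite iterSr.
  split; [apply: rt_trans yx|apply: rt_trans xy _]; apply: rt_step.
    by split=> //; left.
  by split=> //; right.
split=> [y z /to_root[yx _] /to_root[_ xz]|]; first exact: rt_trans yx xz.
exists (x, f x); split=> /=.
  by split; [left|exact: back_orbit_refl|exact: back_orbit_image].
move=> [a b] /= [ab aB bB]; have {aB}/back_orbitP[n fa] := aB.
case: n fa => [|n] fa; last first.
  case: ab => ab; exfalso; apply: bB.
    by apply/back_orbitP; exists n; rewrite -ab -iterSr.
  by apply/back_orbitP; exists n.+2; rewrite iterSr ab.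
move: fa => /= fa; subst a.
case: ab => [<- //|ab]; exfalso; apply: bB.
by apply/back_orbitP; exists 1%N.
Qed.

(** If the boundary edge (a, b) satisfies f a = b then no preimage leaves U, and
    if f b = a then no image does: by uniqueness of the boundary edge, the edge
    along which U is left would be (a, b) itself, oriented both ways by f, a
    2-cycle. *)
Lemma half_space_orbit U x : half_space (fun_graph f) U -> U x ->
  back_orbit f x `<=` U \/ forward_orbit x `<=` U.
Proof.
move=> [_ [[a b] [[/= ab Ua Ub] ab_uniq]]] Ux; case: ab => ab.
  left=> y /back_orbitP[n]; elim: n y => [y /= ->//|n IHn] y.
  rewrite iterSr => /IHn Ufy; apply: contrapT => Uy.
  have [ea eb] : (a, b) = (f y, y) by apply: ab_uniq; split=> //; right.
  apply: (@f_acyclic 2%N y) => //.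
  by rewrite iterSr /= -ea ab.
right=> _ [n _ <-]; elim: n => [//|n IHn]; apply: contrapT => /= Ufn.
have [ea eb] : (a, b) = (iter n f x, f (iter n f x)).
  by apply: ab_uniq; split=> //; left.
by apply: (@f_acyclic 2%N a) => //; rewrite iterSr /= ea -eb ab ea.
Qed.

Lemma half_space_sub_eclass U x : half_space (fun_graph f) U -> U x ->
  U `<=` eclass (fun_equiv f) x.
Proof.
move=> [connU _] Ux y Uy; have := connU _ _ Ux Uy.
elim=> [a b [ab _ _]|a|a b c _ ab _ bc].
- exact: rt_step.
- exact: rt_refl.
- exact: fun_equiv_trans ab bc.
Qed.

End ForwardOrbits.

(** * Lower integrals and measurability up to a null set *)

Lemma esum_subset (R : realType) (I : choiceType) (A B : set I)
    (a : I -> \bar R) : A `<=` B ->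
  (forall x, B x -> 0 <= a x) -> \esum_(x in A) a x <= \esum_(x in B) a x.
Proof.
move=> AB a0; rewrite [leRHS](esumID A)// setIC setIidl// leeDl// esum_ge0//.
by move=> x [/a0].
Qed.

Section LowerIntegral.
Context {R : realType} {d : measure_display} {X : measurableType d}.
Variable mu : probability X R.
Implicit Types (u v : X -> \bar R).

(** For nonnegative functions the integral is a supremum over simple minorants,
    hence monotone even without measurability. *)
Lemma le_lower_integral u v : (forall x, 0 <= u x) -> (forall x, u x <= v x) ->
  \int[mu]_x u x <= \int[mu]_x v x.
Proof.
move=> u0 uv; have v0 x : 0 <= v x by exact: le_trans (u0 x) (uv x).
rewrite !ge0_integralTE//; apply: le_ereal_sup => _ [h /= hu <-].
by exists h => // x; exact: le_trans (hu x) (uv x).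
Qed.

Import HBNNSimple.

Lemma integral_support_null u : (forall x, 0 <= u x) ->
  (forall L, measurable L -> (forall x, L x -> u x != 0) -> mu L = 0) ->
  \int[mu]_x u x = 0.
Proof.
move=> u0 supp0; apply/eqP; rewrite eq_le integral_ge0 ?andbT//.
rewrite ge0_integralTE//; apply: ge_ereal_sup => _ [h /= hu <-].
rewrite -integralT_nnsfun.
have mh : measurable_fun setT (EFin \o h).
  by apply/measurable_EFinP; exact: measurable_funPT.
suff : \int[mu]_x `|(EFin \o h) x| = 0.
  move=> <-; apply: le_lower_integral => x; first by rewrite lee_fin.
  by rewrite /= lee_fin ler_norm.
apply/(ae_eq_integral_abs mu measurableT mh).
exists (~` (h @^-1` [set 0%R])); split.
- by apply: measurableC; rewrite -[_ @^-1` _]setTI; exact: measurable_funPT.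
- apply: supp0 => [|x /= hx0].
    by apply: measurableC; rewrite -[_ @^-1` _]setTI; exact: measurable_funPT.
  have hx : (0 < h x)%R.
    by rewrite lt_neqAle fun_ge0 andbT eq_sym; exact/eqP.
  by rewrite gt_eqF// (lt_le_trans _ (hu x))// lte_fin.
- by move=> x /= /not_implyP[_ hx] /= h0; apply: hx; rewrite /= h0.
Qed.

(** A union of measurable subsets of S whose measures approach their supremum
    cannot be enlarged. *)
Lemma inner_hull (S : set X) : exists L, [/\ measurable L, L `<=` S &
  forall L', measurable L' -> L' `<=` S `\` L -> mu L' = 0].
Proof.
pose M := [set mu L | L in [set L | measurable L /\ L `<=` S]].
have M_fin : ereal_sup M \is a fin_num.
  rewrite ge0_fin_numE; last first.
    by apply: ereal_sup_ubound; exists set0; rewrite ?measure0//; split.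
  apply: le_lt_trans (ltry 1); apply: ge_ereal_sup => _ [L [mL _] <-].
  exact: probability_le1.
have /choice[L Lk] : forall k : nat, exists L, [/\ measurable L, L `<=` S &
    ereal_sup M - (k.+1%:R^-1)%:E < mu L].
  move=> k; have k0 : (0 < k.+1%:R^-1 :> R)%R by rewrite invr_gt0.
  by have [_ [L [mL LS] <-] ltL] := ub_ereal_sup_adherent k0 M_fin; exists L.
have mL : measurable (\bigcup_k L k).
  by apply: bigcup_measurable => k _; case: (Lk k).
exists (\bigcup_k L k); split => //.
  by move=> x [k _]; case: (Lk k) => _ + _; exact.
move=> L' mL' L'S.
have M_le : ereal_sup M <= mu (\bigcup_k L k).
  apply/lee_addgt0Pr => e e0.
  have [k ke] : exists k : nat, (k.+1%:R^-1 < e :> R)%R.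
    exists (Num.truncn (e^-1)); rewrite invf_plt ?posrE//.
    exact: truncnS_gt.
  case: (Lk k) => mLk LkS /ltW; rewrite leeBlDr// => /le_trans; apply.
  apply: leeD; last by rewrite lee_fin ltW.
  by apply: le_measure; rewrite ?inE//; exact: bigcup_sup.
have : mu (\bigcup_k L k `|` L') <= mu (\bigcup_k L k).
  apply: le_trans M_le; apply: ereal_sup_ubound.
  exists (\bigcup_k L k `|` L') => //; split; first exact: measurableU.
  move=> x [[k _]|/L'S[]//]; by case: (Lk k) => _ + _; exact.
rewrite measureU//; last first.
  by apply/seteqP; split => // x [Lx /L'S[]].
have fin : mu (\bigcup_k L k) \is a fin_num by exact: fin_num_measure.
rewrite -leeBrDl// subee// => L'0; apply/eqP.
by rewrite eq_le L'0 measure_ge0.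
Qed.

Lemma negligible_bigcup_count (I : countType) (F : I -> set X) :
  (forall i, mu.-negligible (F i)) -> mu.-negligible (\bigcup_i F i).
Proof.
move=> F0; pose G n := if unpickle n is Some i then F i else set0.
apply: negligibleS (_ : mu.-negligible (\bigcup_n G n)).
  by move=> x [i _ Fx]; exists (pickle i) => //; rewrite /G pickleK.
apply: negligible_bigcup => n; rewrite /G.
by case: unpickle => [i|]; [exact: F0|exact: negligible_set0].
Qed.

(** The measurable representative is required to lie below u: its integral is
    then bounded by the lower integral of u. *)
Definition ae_measurable u : Prop := exists g, [/\ measurable_fun setT g,
  (forall x, 0 <= g x), (forall x, g x <= u x) &
  mu.-negligible [set x | g x <> u x]].

Lemma ae_measurable_sum (I : finType) (u : I -> X -> \bar R) :
  (forall i, ae_measurable (u i)) -> ae_measurable (fun x => \sum_i u i x).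
Proof.
move=> /choice[g ug]; exists (fun x => \sum_i g i x); split.
- by apply: emeasurable_sum => i; case: (ug i).
- by move=> x; apply: sume_ge0 => i _; case: (ug i).
- by move=> x; apply: lee_sum => i _; case: (ug i).
apply: negligibleS (_ : mu.-negligible (\bigcup_i [set x | g i x <> u i x])).
  move=> x /= gu; apply: contrapT => nx; apply: gu; apply: eq_bigr => i _.
  by apply: contrapT => gui; apply: nx; exists i.
by apply: negligible_bigcup_count => i; case: (ug i).
Qed.

Lemma ae_measurable_sup (u : nat -> X -> \bar R) :
  (forall i, ae_measurable (u i)) ->
  ae_measurable (fun x => ereal_sup (range (u ^~ x))).
Proof.
move=> /choice[g ug]; exists (fun x => ereal_sup (range (g ^~ x))); split.
- rewrite (_ : (fun x => _) = (fun x => esups (g ^~ x) 0%N)).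
    by apply: measurable_fun_esups => i; case: (ug i).
  apply/funext => x; rewrite /esups /sdrop; congr ereal_sup.
  by apply/seteqP; split => _ [n _ <-]; exists n.
- move=> x; case: (ug 0%N) => _ /(_ x) g0 _ _.
  by apply: le_trans g0 _; apply: ereal_sup_ubound; exists 0%N.
- move=> x; apply: ge_ereal_sup => _ [n _ <-]; case: (ug n) => _ _ gu _.
  by apply: (le_trans (gu x)); apply: ereal_sup_ubound; exists n.
apply: negligibleS (_ : mu.-negligible (\bigcup_i [set x | g i x <> u i x])).
  move=> x /= gu; apply: contrapT => nx; apply: gu.
  suff -> : g ^~ x = u ^~ x by [].
  apply/funext => i.
  by apply: contrapT => gui; apply: nx; exists i.
by apply: negligible_bigcup_count => i; case: (ug i).
Qed.

(** Needs measurability up to a null set: the function equal to +oo on a set of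
    inner measure 0, and to 0 elsewhere, has lower integral 0 whatever the outer
    measure of that set. *)
Lemma ae_measurable_lty u : ae_measurable u -> \int[mu]_x u x < +oo ->
  mu.-negligible [set x | u x = +oo].
Proof.
move=> [g [mg g0 gu g_eq]] u_fin.
have : mu.-integrable setT g.
  apply/integrableP; split => //; apply: le_lt_trans u_fin.
  apply: le_lower_integral => x; first exact: abse_ge0.
  by rewrite gee0_abs.
move=> /(integrable_ae measurableT) g_fin.
apply: negligibleS (negligibleU g_eq g_fin) => x /= ux.
have [gx|gx] := pselect (g x = u x); [right|by left].
by move=> /(_ Logic.I); rewrite gx ux.
Qed.

End LowerIntegral.

(** * Images under the iterates are measurable up to a null set *)

Section MassTransport.
Context {R : realType} {d : measure_display} {X : measurableType d}.
Variable mu : probability X R.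

Definition almost_measurable (S : set X) : Prop := exists L,
  [/\ measurable L, L `<=` S & mu.-negligible (S `\` L)].

Lemma almost_measurable_bigcup (S : nat -> set X) :
  (forall n, almost_measurable (S n)) -> almost_measurable (\bigcup_n S n).
Proof.
move=> /choice[L SL]; exists (\bigcup_n L n); split.
- by apply: bigcup_measurable => n _; case: (SL n).
- by apply: subset_bigcup => n _; case: (SL n).
apply: negligibleS (_ : mu.-negligible (\bigcup_n (S n `\` L n))).
  move=> x [[n _ Sx] nL]; exists n => //; split => // Lx.
  by apply: nL; exists n.
by apply: negligible_bigcup => n; case: (SL n).
Qed.

Lemma ae_measurable_indic (S : set X) (c : R) : (0 <= c)%R ->
  almost_measurable S -> ae_measurable mu (fun x => (c * \1_S x)%:E).
Proof.
move=> c0 [L [mL LS SL0]]; exists (fun x => (c * \1_L x)%:E); split.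
- apply/measurable_EFinP; apply: measurable_funM => //.
- by move=> x; rewrite lee_fin mulr_ge0.
- move=> x; rewrite lee_fin ler_wpM2l// !indicE ler_nat.
  by case: (boolP (x \in L)) => //; rewrite inE => /LS/mem_set->.
apply: negligibleS SL0 => x /= neq; apply: contrapT => nSL; apply: neq.
rewrite !indicE; suff -> : (x \in L) = (x \in S) by [].
apply/idP/idP; rewrite !inE; first exact: LS.
by move=> Sx; apply: contrapT => Lx; apply: nSL.
Qed.

Variable f : X -> X.
Hypothesis f_borel : measurable_fun setT f.
Hypothesis f_acyclic : acyclic_fun f.
Variable U : nat -> set X.
Hypothesis mU : forall i, measurable (U i).
Hypothesis U_sep : separating U.

Lemma measurable_iter n : measurable_fun setT (iter n f).
Proof.
by elim: n => [|n IHn]; [exact: measurable_id|exact: measurableT_comp].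
Qed.

Lemma measurable_coincidence d' (Y : measurableType d') (g h : Y -> X) :
  measurable_fun setT g -> measurable_fun setT h ->
  measurable [set y | g y = h y].
Proof.
move=> mg mh.
have mgh : measurable_fun setT (fun y => (g y, h y)).
  exact: measurable_fun_pair.
by have := mgh measurableT _ (measurable_diagonal mU U_sep); rewrite setTI.
Qed.

Lemma measurable_fun_equiv :
  measurable [set p : X * X | fun_equiv f p.1 p.2].
Proof.
rewrite (_ : [set p | _] = \bigcup_m \bigcup_n
    [set p : X * X | iter m f p.1 = iter n f p.2]).
  apply: bigcup_measurable => m _; apply: bigcup_measurable => n _.
  apply: measurable_coincidence.
    by apply: measurableT_comp measurable_fst; exact: measurable_iter.
  by apply: measurableT_comp measurable_snd; exact: measurable_iter.
apply/seteqP; split => [[x y] /= /fun_equivP[m [n xy]]|[x y] [m _ [n _ /= xy]]].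
  by exists m => //; exists n.
by apply/fun_equivP; exists m, n.
Qed.

Lemma measurable_back_orbit_graph :
  measurable [set p : X * X | back_orbit f p.1 p.2].
Proof.
rewrite (_ : [set p | _] = \bigcup_n [set p : X * X | iter n f p.2 = p.1]).
  apply: bigcup_measurable => n _; apply: measurable_coincidence => //.
  by apply: measurableT_comp measurable_snd; exact: measurable_iter.
apply/seteqP; split => [[x y] /= /back_orbitP[n xy]|[x y] [n _ /= xy]].
  by exists n.
by apply/back_orbitP; exists n.
Qed.

Lemma measurable_along_iter d' (Y : measurableType d') (w : X * X -> Y) n :
  measurable_fun [set p | fun_equiv f p.1 p.2] w ->
  measurable_fun setT (fun y => w (iter n f y, y)).
Proof.
move=> mw; apply: (measurable_comp measurable_fun_equiv _ mw).
  by move=> _ [y _ <-] /=; apply/fun_equiv_sym/fun_equiv_iter.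
by apply: measurable_fun_pair; [exact: measurable_iter|exact: measurable_id].
Qed.

Hypothesis f_mcp : mcp mu (fun_equiv f).
Variable rho : X * X -> R.
Hypothesis rho_RN : is_RN_cocycle mu (fun_equiv f) rho.

(** The points of B sent into the image but outside its inner hull L transport
    mass only to a set without measurable subsets of positive measure, so they
    form a null set; its saturation is null and contains the rest of the
    image. *)
Lemma almost_measurable_image n (B : set X) : measurable B ->
  almost_measurable (iter n f @` B).
Proof.
case: rho_RN => rho_gt0 mrho _ transport mB.
have [L [mL LB L_max]] := inner_hull mu (iter n f @` B).
exists L; split => //.
pose B' := B `&` iter n f @^-1` (~` L).
have mB' : measurable B'.
  apply: measurableI => //; rewrite -[_ @^-1` _]setTI.
  by apply: measurable_iter => //; exact: measurableC.
suff B'0 : mu.-negligible B'.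
  apply: negligibleS (f_mcp B'0) => _ [[y By <-] Ly].
  by exists y => //; exact: fun_equiv_iter.
pose H := [set p : X * X | iter n f p.2 = p.1] `&` snd @^-1` B'.
have mH : measurable H.
  apply: measurableI.
    apply: measurable_coincidence => //.
    by apply: measurableT_comp measurable_snd; exact: measurable_iter.
  by rewrite -[_ @^-1` _]setTI; exact: measurable_snd.
have := transport (fun p => (\1_H p)%:E); rewrite integral_support_null.
- move=> /(_ _ _)/esym int0.
  pose g y := (rho (iter n f y, y) * \1_B' y)%R.
  have g0 y : (0 <= g y)%R.
    rewrite mulr_ge0// ltW// rho_gt0//; exact/fun_equiv_sym/fun_equiv_iter.
  have mg : measurable_fun setT (EFin \o g).
    apply/measurable_EFinP; apply: measurable_funM => //.
    exact: measurable_along_iter.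
  have : \int[mu]_y `|(EFin \o g) y| = 0.
    apply/eqP; rewrite eq_le integral_ge0 ?andbT//.
    rewrite -[leRHS]int0//; last first.
      apply: measurable_funTS; apply/measurable_EFinP.
      exact: measurable_indic.
    apply: le_lower_integral => y //; rewrite gee0_abs ?lee_fin//.
    apply: esum_ge; exists [set iter n f y].
      by split; [exact: finite_set1|move=> _ ->; exact: fun_equiv_iter].
    rewrite fsbig_set1 -EFinM lee_fin mulrC /g ler_wpM2l//.
      rewrite ltW// rho_gt0//; exact/fun_equiv_sym/fun_equiv_iter.
    rewrite !indicE ler_nat; case: (boolP (y \in B')) => //.
    by rewrite inE => B'y; rewrite mem_set.
  move=> /(ae_eq_integral_abs mu measurableT mg)[N [mN N0 gN]].
  exists N; split => // y B'y; apply: gN => /= /(_ Logic.I)[].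
  apply/eqP; rewrite /g indicE mem_set// mulr1 gt_eqF// rho_gt0//.
  exact/fun_equiv_sym/fun_equiv_iter.
- by move=> x; exact: esum_ge0.
move=> L' mL' L'H; apply: L_max => // z /L'H nz.
suff [y [fy B'y]] : exists y, H (z, y).
  by split; [exists y => //; case: B'y|rewrite -[z]fy; case: B'y].
apply: contrapT => nH; move/eqP: nz; apply; apply: esum1 => y _.
by rewrite indicE memNset// => Hzy; apply: nH; exists y.
Qed.

(** * Sums over back orbits *)

(** Labels the atom containing y of the partition generated by the first n
    separating sets. *)
Definition code n y : {ffun 'I_n -> bool} := [ffun i : 'I_n => `[< U i y >]].

Lemma measurable_code n t : measurable [set y | code n y = t].
Proof.
rewrite (_ : [set y | _] =
    \bigcap_(i in [set` enum 'I_n]) (if t i then U i else ~` U i)).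
  apply: fin_bigcap_measurable => // i _.
  by case: ifP => _ //; exact: measurableC.
apply/seteqP; split => [y /= <- i _|y yt].
  by rewrite ffunE; case: asboolP.
apply/ffunP => i; rewrite ffunE; have := yt i; rewrite /= mem_enum => /(_ isT).
by case: (t i) => [/asboolT//|/asboolF].
Qed.

Lemma code_injective (l : seq X) : exists n, {in l &, injective (code n)}.
Proof.
have /choice[sep sepP] (p : X * X) : exists i,
    p.1 <> p.2 -> U i p.1 <> U i p.2.
  have [eqp|/U_sep[i Ux Uy]] := pselect (p.1 = p.2); first by exists 0%N.
  by exists i => _; move=> e; apply: Uy; rewrite -e.
exists (\max_(p <- [seq (x, y) | x <- l, y <- l]) (sep p).+1)%N => x y xl yl e.
apply: contrapT => /(sepP (x, y)); apply.
have lt_sep : (sep (x, y) <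
    \max_(p <- [seq (x, y) | x <- l, y <- l]) (sep p).+1)%N.
  by apply: (leq_bigmax_seq (x, y)) => //; apply/allpairsP; exists (x, y).
have /ffunP/(_ (Ordinal lt_sep)) := e; rewrite !ffunE /= => {}e.
apply/propext; split => u; [apply/asboolP; rewrite -e|apply/asboolP; rewrite e];
  exact/asboolP.
Qed.

Lemma le_sum_code n (u : {ffun 'I_n -> bool} -> \bar R) (l : seq X) :
  (forall t, 0 <= u t) -> uniq l -> {in l &, injective (code n)} ->
  \sum_(y <- l) u (code n y) <= \sum_t u t.
Proof.
move=> u0 l_uniq code_inj; rewrite -(big_map (code n) predT u).
have map_uniq : uniq (map (code n) l) by rewrite map_inj_in_uniq.
rewrite big_uniq//= [leRHS](bigID (mem (map (code n) l)))/=.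
by rewrite leeDl// sume_ge0.
Qed.

(** The sum is the supremum over n of the sums over the atoms t of the n-th
    partition of the supremum u n t z of w (z, y) over the y of t in the back
    orbit of z: any finitely many points eventually lie in distinct atoms.
    Moreover u n t is a supremum of rational multiples of indicators of images
    of measurable sets. *)
Lemma ae_measurable_back_sum (w : X * X -> R) :
  measurable_fun [set p | fun_equiv f p.1 p.2] w ->
  (forall x y, fun_equiv f x y -> (0 <= w (x, y))%R) ->
  ae_measurable mu (fun z => \esum_(y in back_orbit f z) (w (z, y))%:E).
Proof.
move=> mw w_ge0.
have w0 z y : back_orbit f z y -> 0 <= (w (z, y))%:E.
  by move=> zy; rewrite lee_fin w_ge0//; exact: back_orbit_sub.
(* Absolute values keep the approximating functions nonnegative. *)
pose q k : R := `|ratr (odflt 0 (unpickle k))|%R.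
pose I n t k : set X := \bigcup_m
  (iter m f @` [set y | code n y = t /\ (q k <= w (iter m f y, y))%R]).
pose u n t z := ereal_sup (range (fun k => (q k * \1_(I n t k) z)%:E)).
have u_meas n t : ae_measurable mu (u n t).
  apply: ae_measurable_sup => k.
  apply: ae_measurable_indic; first exact: normr_ge0.
  apply: almost_measurable_bigcup => m; apply: almost_measurable_image.
  apply: measurableI; first exact: measurable_code.
  have := measurable_along_iter m mw measurableT (measurable_itv `[q k, +oo[).
  rewrite setTI; congr measurable; apply/seteqP.
  by split => y /=; rewrite in_itv/= andbT.
have u0 n t z : 0 <= u n t z.
  by case: (u_meas n t) => g [_ g0 gu _]; exact: le_trans (g0 z) (gu z).
rewrite (_ : (fun z => _) =
    (fun z => ereal_sup (range (fun n => \sum_t u n t z)))).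
  by apply: ae_measurable_sup => n; exact: ae_measurable_sum.
apply/funext => z; apply/eqP; rewrite eq_le; apply/andP; split.
  apply: ge_ereal_sup => _ [F [finF F_back] <-].
  rewrite fsbig_finite//=.
  have [n code_inj] := code_injective (finmap.enum_fset (fset_set F)).
  have le_n : \sum_t u n t z <= ereal_sup (range (fun n => \sum_t u n t z)).
    by apply: ereal_sup_ubound; exists n.
  apply: le_trans le_n.
  have l_uniq := finmap.fset_uniq (fset_set F).
  apply: le_trans (@le_sum_code n (fun t => u n t z) _ _ l_uniq code_inj) => //.
  rewrite big_seq [leRHS]big_seq; apply: lee_sum => y.
  rewrite in_fset_set// inE => /F_back zy; rewrite leNgt; apply/negP => ltw.
  have u_fin : u n (code n y) z \is a fin_num.
    by rewrite ge0_fin_numE// (lt_trans ltw)// ltry.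
  move: ltw; rewrite -(fineK u_fin) lte_fin => /rat_in_itvoo[r].
  rewrite in_itv/= => /andP[ur rw].
  have r0 : (0 <= ratr r :> R)%R by rewrite ltW// (le_lt_trans _ ur)// fine_ge0.
  have : (q (pickle r) * \1_(I n (code n y) (pickle r)) z)%:E
      <= u n (code n y) z.
    by apply: ereal_sup_ubound; exists (pickle r).
  rewrite /q pickleK/= ger0_norm// indicE mem_set ?mulr1.
    by rewrite -(fineK u_fin) lee_fin leNgt ur.
  have /back_orbitP[m myz] := zy.
  by exists m => //; exists y => //; rewrite /q pickleK/= ger0_norm// myz ltW.
apply: ge_ereal_sup => _ [n _ <-].
have u_le t : u n t z <= \esum_(y in back_orbit f z)
    (if code n y == t then (w (z, y))%:E else 0).
  have sum0 y : back_orbit f z y ->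
      0 <= (if code n y == t then (w (z, y))%:E else 0).
    by move=> zy; case: ifP => // _; exact: w0.
  apply: ge_ereal_sup => _ [k _ <-]; rewrite indicE.
  have [|_] := boolP (z \in I n t k); last by rewrite mulr0 esum_ge0.
  rewrite inE mulr1 => -[m _ [y [ct qw] myz]].
  apply: esum_ge; exists [set y].
    by split; [exact: finite_set1|move=> _ ->; apply/back_orbitP; exists m].
  by rewrite fsbig_set1 ct eqxx lee_fin -myz.
apply: le_trans (lee_sum _ (fun t _ => u_le t)) _.
rewrite -esum_sum; last by move=> y t zy _; case: ifP => // _; exact: w0.
by apply: le_esum => y zy; rewrite -big_mkcond/= (big_pred1 (code n y)).
Qed.

(** Mass transport: the integral of the back sums equals that of the forward
    sums weighted by the cocycle, and the latter is at most C. *)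
Lemma back_sum_lty (w : X * X -> R) (C : R) :
  measurable_fun [set p | fun_equiv f p.1 p.2] w ->
  (forall x y, fun_equiv f x y -> (0 <= w (x, y))%R) ->
  (forall y,
     \esum_(z in forward_orbit f y) (w (z, y) * rho (z, y))%:E <= C%:E) ->
  mu.-negligible [set z | \esum_(y in back_orbit f z) (w (z, y))%:E = +oo].
Proof.
case: rho_RN => rho_gt0 mrho _ transport mw w_ge0 wC.
apply: ae_measurable_lty; first exact: ae_measurable_back_sum.
pose B := [set p : X * X | back_orbit f p.1 p.2].
pose h p := (w p * \1_B p)%:E.
have h_ge0 x y : fun_equiv f x y -> 0 <= h (x, y).
  by move=> xy; rewrite lee_fin mulr_ge0// w_ge0.
have mh : measurable_fun [set p | fun_equiv f p.1 p.2] h.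
  apply/measurable_EFinP; apply: measurable_funM => //.
  by apply: measurable_funTS; apply: measurable_indic;
    exact: measurable_back_orbit_graph.
rewrite (_ : (fun z => _) =
    (fun z => \esum_(y in eclass (fun_equiv f) z) h (z, y))).
  rewrite transport//; apply: le_lt_trans (ltry C).
  have -> : C%:E = \int[mu]_y (cst C%:E y).
    rewrite integral_cst// -[LHS]mule1; congr (_ * _).
    by rewrite -(probability_setT mu).
  apply: le_lower_integral => y.
    apply: esum_ge0 => z yz; apply: mule_ge0.
      by apply: h_ge0; exact: fun_equiv_sym.
    by rewrite lee_fin ltW// rho_gt0//; exact: fun_equiv_sym.
  apply: le_trans (wC y).
  rewrite esum_mkcond [leRHS]esum_mkcond; apply: le_esum => z _.
  case: (boolP (z \in forward_orbit f y)) => [|nz].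
    rewrite inE => yz; rewrite mem_set; last exact: forward_orbit_sub.
    by rewrite /h indicE mem_set ?mulr1//; apply/forward_orbitE.
  case: ifP => // _; rewrite /h indicE memNset ?mulr0 ?mul0e//.
  by move=> /forward_orbitE yz; move: nz; rewrite mem_set.
apply/funext => z; rewrite [LHS]esum_mkcond [RHS]esum_mkcond.
apply: eq_esum => y _; rewrite /h indicE.
case: (boolP (y \in back_orbit f z)); rewrite ?inE => zy.
  rewrite [y \in _]mem_set; last exact: back_orbit_sub.
  by rewrite mem_set// mulr1.
rewrite (_ : _ \in B = false) ?mulr0 ?if_same//.
by apply: memNset => zyB; move: zy; rewrite mem_set.
Qed.

(** * Invariant null sets and changes of base point *)

(** Alternate taking saturations and measurable null supersets; the union is
    both measurable and invariant. *)
Lemma invariant_null_cover (A : set X) : mu.-negligible A -> exists N,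
  [/\ measurable N, mu N = 0, invariant_set (fun_equiv f) N & A `<=` N].
Proof.
move=> A0.
have /choice[c c_cover] (S : set X) : exists W, mu.-negligible S ->
    [/\ measurable W, mu W = 0 & saturation (fun_equiv f) S `<=` W].
  have [/f_mcp[W SW]|nS] := pselect (mu.-negligible S); first by exists W.
  by exists set0.
have S0 n : mu.-negligible (iter n c A).
  elim: n => [//|n /c_cover[mW W0 _]]; exact/negligibleP.
exists (\bigcup_n iter n.+1 c A); split.
- by apply: bigcup_measurable => n _; case: (c_cover _ (S0 n)).
- have mW : measurable (\bigcup_n iter n.+1 c A).
    by apply: bigcup_measurable => n _; case: (c_cover _ (S0 n)).
  apply/(negligibleP _ mW); apply: negligible_bigcup => n; exact: S0.
- move=> x y xy [n _ Wx]; exists n.+1 => //.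
  by have [_ _] := c_cover _ (S0 n.+1); apply; exists x.
- move=> x Ax; exists 0%N => //; have [_ _] := c_cover _ (S0 0%N).
  by apply; exists x => //; exact: rt_refl.
Qed.

Let rho_gt0 x y : fun_equiv f x y -> (0 < rho (x, y))%R.
Proof. by case: rho_RN => + _ _ _; exact. Qed.

Let rho_ge0 x y : fun_equiv f y x -> 0 <= (rho (x, y))%:E.
Proof.
by move=> yx; have xy := fun_equiv_sym yx; rewrite lee_fin ltW// rho_gt0.
Qed.

Lemma cocycle_inv x y : fun_equiv f x y -> (rho (y, x) * rho (x, y) = 1)%R.
Proof.
case: rho_RN => _ _ cocycle _ xy; have yx := fun_equiv_sym xy.
have xx := fun_equiv_trans xy yx; have yy := fun_equiv_trans yx xy.
rewrite cocycle//; apply: (mulfI (lt0r_neq0 (rho_gt0 yy))).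
by rewrite cocycle// mulr1.
Qed.

(** Changing the base point multiplies the sum by a positive real number. *)
Lemma rho_infinite_at x (D : set X) : D `<=` eclass (fun_equiv f) x ->
  rho_infinite (fun_equiv f) rho D <-> \esum_(y in D) (rho (y, x))%:E = +oo.
Proof.
move=> Dx; split=> [[x' Dx' sum_oo]|sum_oo]; last by exists x.
have [x'x|nx'x] := pselect (fun_equiv f x' x); last first.
  move: sum_oo; rewrite esum1// => y Dy; case: nx'x.
  exact: fun_equiv_trans (Dx' _ Dy) (fun_equiv_sym (Dx _ Dy)).
apply/eqP; rewrite -leye_eq leNgt; apply/negP => sum_fin.
have sum_ge0 : 0 <= \esum_(y in D) (rho (y, x))%:E.
  by apply: esum_ge0 => y /Dx; exact: rho_ge0.
suff : \esum_(y in D) (rho (y, x'))%:E <=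
    (rho (x, x'))%:E * \esum_(y in D) (rho (y, x))%:E.
  rewrite sum_oo leye_eq => /eqP oo.
  have : (rho (x, x'))%:E * (\esum_(y in D) (rho (y, x))%:E) < +oo.
    by rewrite lte_mul_pinfty// rho_ge0.
  by rewrite oo.
apply: ge_ereal_sup => _ [F [finF FD] <-].
have -> : \sum_(y \in F) (rho (y, x'))%:E =
    (rho (x, x'))%:E * \sum_(y \in F) (rho (y, x))%:E.
  rewrite !fsbig_finite//= !sumEFin -EFinM mulr_sumr; congr (_%:E).
  apply: eq_big_seq => y; rewrite in_fset_set// inE => /FD/Dx xy.
  by case: rho_RN => _ _ cocycle _; rewrite mulrC cocycle.
by apply: lee_wpmul2l; [exact: rho_ge0|apply: esum_ge; exists F].
Qed.

(** * Finite forward mass forces finite backward mass *)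

Definition forward_mass x := \esum_(z in forward_orbit f x) (rho (z, x))%:E.

Lemma measurable_forward_mass : measurable_fun setT forward_mass.
Proof.
rewrite (_ : forward_mass =
    fun x => \sum_(0 <= n <oo) (rho (iter n f x, x))%:E).
  apply: ge0_emeasurable_sum => [n x _ _|n _].
    exact/rho_ge0/fun_equiv_iter.
  apply/measurable_EFinP; case: rho_RN => _ mrho _ _.
  exact: measurable_along_iter.
apply/funext => x; rewrite nneseries_esumT => [|n]; last first.
  exact/rho_ge0/fun_equiv_iter.
rewrite /forward_mass /forward_orbit esum_image// => m n _ _; exact: iter_inj.
Qed.

Definition back_count (A : set X) z :=
  \esum_(y in back_orbit f z) (\1_A y : R)%:E.

(** The later point is counted itself, and by acyclicity it is not in the back
    orbit of the earlier one. *)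
Lemma back_count_step A z n : A (iter n.+1 f z) ->
  back_count A z + 1 <= back_count A (iter n.+1 f z).
Proof.
move=> Az; rewrite /back_count [leRHS](esumID (back_orbit f z))//.
have zz : back_orbit f (iter n.+1 f z) z by apply/back_orbitP; exists n.+1.
rewrite (_ : _ `&` back_orbit f z = back_orbit f z); last first.
  by apply/setIidr => y; exact: back_orbit_trans.
apply: leeD => //; apply: esum_ge; exists [set iter n.+1 f z].
  split; first exact: finite_set1.
  move=> _ ->; split; first exact: back_orbit_refl.
  move=> /back_orbitP[m]; rewrite -iterD addnS; exact: f_acyclic.
by rewrite fsbig_set1 indicE mem_set.
Qed.

(** Each y sends mass rho (y, z) to its only visit z of B; weighted by
    rho (z, y) this is 1. *)
Lemma back_sum_fin_of_visit_once (B : set X) : measurable B ->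
  (forall z n, B z -> ~ B (iter n.+1 f z)) ->
  mu.-negligible
    [set z | B z /\ \esum_(y in back_orbit f z) (rho (y, z))%:E = +oo].
Proof.
move=> mB B_once; pose w p : R := (\1_B p.1 * rho (p.2, p.1))%R.
have w_ge0 x y : fun_equiv f x y -> (0 <= w (x, y))%R.
  by move=> xy; rewrite mulr_ge0// -lee_fin rho_ge0.
have mw : measurable_fun [set p | fun_equiv f p.1 p.2] w.
  apply: measurable_funM.
    apply: measurable_funTS; apply: measurableT_comp => //.
  case: rho_RN => _ mrho _ _.
  apply: (measurable_comp measurable_fun_equiv _ mrho).
    by move=> _ [[x y] /= xy <-]; exact: fun_equiv_sym.
  apply: measurable_funTS; apply: measurable_fun_pair.
    exact: measurable_snd.
  exact: measurable_fst.
apply: negligibleS (@back_sum_lty w 1 mw w_ge0 _) => [z [Bz zoo]|y] /=.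
  rewrite -[RHS]zoo; apply: eq_esum => y _.
  by rewrite /w /= indicE mem_set// mul1r.
rewrite (_ : \esum_(z in forward_orbit f y) _ =
  \esum_(z in forward_orbit f y) (\1_B z : R)%:E); last first.
  apply: eq_esum => z yz; have {}yz := forward_orbit_sub yz.
  by rewrite /w /= -mulrA (cocycle_inv (fun_equiv_sym yz)) mulr1.
have [[z0 [yz0 Bz0]]|nB] := pselect (exists z, forward_orbit f y z /\ B z).
  rewrite (_ : \esum_(z in _) _ =
    \esum_(z in forward_orbit f y) (if z \in [set z0] then 1 else 0)).
    rewrite -esum_mkcondr (_ : _ `&` _ = [set z0]) ?esum_set1//.
    by apply/setIidr => _ ->.
  apply: eq_esum => z yz; rewrite indicE.
  have [zz0|zz0] := boolP (z \in [set z0]).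
    by move: zz0; rewrite inE => ->; rewrite mem_set.
  rewrite memNset// => Bz; move/negP: zz0; apply; rewrite inE /=.
  move: yz0 yz Bz0 Bz => [m _ <-] [n _ <-] Bm Bn.
  have [mn|nm|-> //] := ltngtP m n; exfalso.
    apply: (B_once (iter m f y) (n - m.+1)%N) => //.
    by rewrite -iterD -subSn// subSS subnK// ltnW.
  apply: (B_once (iter n f y) (m - n.+1)%N) => //.
  by rewrite -iterD -subSn// subSS subnK// ltnW.
rewrite esum1// => z yz; rewrite indicE memNset// => Bz.
by apply: nB; exists z.
Qed.

(** The points of forward mass at most C are partitioned according to the number
    of such points in their back orbit, which is finite almost everywhere; each
    piece is visited at most once by every forward orbit. *)
Lemma back_sum_fin_of_forward_sum_fin :
  mu.-negligible [set x | \esum_(z in forward_orbit f x) (rho (z, x))%:E < +oo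
    /\ \esum_(y in back_orbit f x) (rho (y, x))%:E = +oo].
Proof.
pose A C := [set x | forward_mass x <= C%:R%:E].
have mA C : measurable (A C).
  rewrite (_ : A C = forward_mass @^-1` [set` `]-oo, C%:R%:E]]).
    rewrite -[X in measurable X]setTI.
    by apply: measurable_forward_mass => //; exact: emeasurable_itv.
  by apply/seteqP; split => x /=; rewrite in_itv.
have N_back C : ae_measurable mu (back_count (A C)) /\
    mu.-negligible [set z | back_count (A C) z = +oo].
  have mw : measurable_fun [set p : X * X | fun_equiv f p.1 p.2]
      (fun p => \1_(A C) p.2 : R).
    by apply: measurable_funTS; apply: measurableT_comp.
  split; first exact: ae_measurable_back_sum mw _.
  apply: (back_sum_lty (C := C%:R) mw) => // y /=.
  have [Ay|Ay] := pselect (A C y).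
    by rewrite indicE mem_set//; under eq_esum do rewrite mul1r.
  by rewrite indicE memNset// esum1// => z _; rewrite mul0r.
have /choice[g gN] C : exists g : X -> \bar R, measurable_fun setT g /\
    mu.-negligible [set z | g z <> back_count (A C) z].
  by have [[g [mg _ _ g_eq]] _] := N_back C; exists g.
have [Z [mZ Z0 NZ]] : mu.-negligible (\bigcup_C
    ([set z | g C z <> back_count (A C) z] `|`
     [set z | back_count (A C) z = +oo])).
  apply: negligible_bigcup => C; apply: negligibleU; first by case: (gN C).
  by case: (N_back C).
have gNE C z : ~ Z z -> g C z = back_count (A C) z.
  move=> nZ; apply: contrapT => ?; apply: nZ; apply: NZ.
  by exists C => //; left.
(* Half-open unit intervals stand for the single values of the integer-valued
   count.  Off Z the measurable representative g is the count itself. *)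
pose B Ck : set X := A Ck.1 `&` g Ck.1 @^-1` [set` `[Ck.2%:R%:E, Ck.2.+1%:R%:E[]
  `&` ~` Z.
have mB Ck : measurable (B Ck).
  apply: measurableI; last exact: measurableC.
  apply: measurableI => //; rewrite -[X in measurable X]setTI.
  by case: (gN Ck.1) => mg _; apply: mg => //; exact: emeasurable_itv.
have B_once Ck z n : B Ck z -> ~ B Ck (iter n.+1 f z).
  move=> [[_ /= gz] Zz] [[/= Az' gz'] Zz'].
  have := back_count_step Az'; rewrite -!gNE//.
  move: gz gz'; rewrite !in_itv/= => /andP[gz _] /andP[_ gz'].
  apply/negP; rewrite -ltNge (lt_le_trans gz')// -natr1 EFinD leeD2r//.
have Z_neg : mu.-negligible Z by apply/negligibleP.
have B_neg Ck := back_sum_fin_of_visit_once (mB Ck) (B_once Ck).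
apply: negligibleS (negligibleU Z_neg (negligible_bigcup_count B_neg)).
move=> x /= [Kx rx]; have [Zx|Zx] := pselect (Z x); [by left|right].
have Kx0 : 0 <= forward_mass x.
  by apply: esum_ge0 => z xz; exact/rho_ge0/forward_orbit_sub.
have Kx_fin : forward_mass x \is a fin_num by rewrite ge0_fin_numE.
pose C := (Num.truncn (fine (forward_mass x))).+1.
have Ax : A C x.
  by rewrite /A /= -(fineK Kx_fin) lee_fin ltW// truncnS_gt.
have Nx0 : 0 <= back_count (A C) x by exact: esum_ge0.
have Nx_fin : back_count (A C) x \is a fin_num.
  rewrite ge0_fin_numE// ltey; apply/eqP => Nx; apply: Zx; apply: NZ.
  by exists C => //; right.
exists (C, Num.truncn (fine (back_count (A C) x))) => //.
split => //; split => //.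
have r0 := fine_ge0 Nx0.
split => //=; rewrite gNE// in_itv/=.
move: (fineK Nx_fin) r0; set r := fine _ => <- r0.
by rewrite lee_fin lte_fin truncn_le r0 truncnS_gt.
Qed.

End MassTransport.

(** * The two cores agree *)

Unset Implicit Arguments.

Theorem proposition4p6 (R : realType) (d : measure_display)
    (X : measurableType d) (X_standard : standard_borel R X)
    (mu : probability X R) (f : X -> X) (f_acyclic : acyclic_fun f)
    (f_countable : countable_to_one f) (f_borel : measurable_fun setT f)
    (f_mcp : mcp mu (fun_equiv f)) (rho : X * X -> R)
    (rho_RN : is_RN_cocycle mu (fun_equiv f) rho) :
  exists N : set X,
    [/\ measurable N, mu N = 0, invariant_set (fun_equiv f) N &
        directed_RN_vertex_core f rho `\` N =
        RN_vertex_core (fun_graph f) rho `\` N].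
Proof.
have [U mU U_sep] := standard_borel_separating X_standard.
have [N [mN N0 invN badN]] := invariant_null_cover f_mcp
  (back_sum_fin_of_forward_sum_fin f_borel f_acyclic mU U_sep f_mcp rho_RN).
exists N; split => //; apply/seteqP; split => x [x_core Nx]; split => //.
  have {}x_core := (rho_infinite_at rho_RN (@back_orbit_sub _ f x)).1 x_core.
  move=> V V_half Vx; have Vsub := half_space_sub_eclass V_half Vx.
  apply: (rho_infinite_at rho_RN Vsub).2.
  have rho_ge0 y : V y -> 0 <= (rho (y, x))%:E.
    move=> Vy; have yx := fun_equiv_sym (Vsub _ Vy).
    case: rho_RN => rho_gt0 _ _ _.
    by rewrite lee_fin ltW// rho_gt0.
  have [backV|fwdV] := half_space_orbit f_acyclic V_half Vx.
    by apply/eqP; rewrite -leye_eq -x_core; exact: esum_subset.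
  apply: contrapT => V_fin; apply: Nx; apply: badN; split => //.
  apply: le_lt_trans (esum_subset fwdV rho_ge0) _.
  by rewrite ltey; exact/eqP.
by apply: x_core; [exact: back_orbit_half_space|exact: back_orbit_refl].
Qed.
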